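(* Let $V$ be a vector space over a field $k$ and let $\varphi,\psi\in\mathrm{End}_k(V)$ be two finite potent endomorphisms. Then: (I) $\varphi\leq^{GD1-1GD}\psi$ if and only if $\varphi\leq^{GD}\psi$; (II) $\varphi\leq^{1GD-GD1}\psi$ if and only if $\varphi\leq^{-}\psi$.
   Context: $k$ is an arbitrary field, $V$ an arbitrary (possibly infinite-dimensional) $k$-vector space. An endomorphism $\varphi\in\mathrm{End}_k(V)$ is finite potent if $\varphi^n(V)$ is finite dimensional for some $n\ge 1$. For such $\varphi$ there is a unique $\varphi$-invariant decomposition $V=W_\varphi\oplus U_\varphi$ (the AST decomposition) with $W_\varphi$ finite dimensional, $\varphi|_{W_\varphi}$ an automorphism of $W_\varphi$, and $\varphi|_{U_\varphi}$ nilpotent; the index $m=i(\varphi)$ is the nilpotency order of $\varphi|_{U_\varphi}$ ($i(\varphi)=0$ iff $V$ is finite dimensional and $\varphi$ is an automorphism). A $\{1\}$-inverse of $\varphi$ is $\varphi^-\in\mathrm{End}_k(V)$ with $\varphi\varphi^-\varphi=\varphi$; the set of them is $X_\varphi(1)$, and $X_\varphi^{fp}(1)$ is the subset of those that are finite potent. A G-Drazin inverse of $\varphi$ is $\varphi^{GD}\in\mathrm{End}_k(V)$ with $\varphi\varphi^{GD}\varphi=\varphi$ and $\varphi^{GD}\varphi^m=\varphi^m\varphi^{GD}$; the set of them is $X_\varphi(GD)$. $X_\varphi(GD1)$ (GD1 inverses) is the set of $\chi\in\mathrm{End}_k(V)$ such that $\chi\varphi\chi=\chi$, $\chi\varphi=\varphi^{GD}\varphi$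 and $\varphi\chi=\varphi\varphi^-$ for some $\varphi^-\in X_\varphi(1)$, $\varphi^{GD}\in X_\varphi(GD)$. $X_\varphi(1GD)$ (1GD inverses) is the set of $\chi\in\mathrm{End}_k(V)$ such that $\chi\varphi\chi=\chi$, $\chi\varphi=\varphi^-\varphi$ and $\varphi\chi=\varphi\varphi^{GD}$ for some $\varphi^-\in X_\varphi(1)$, $\varphi^{GD}\in X_\varphi(GD)$. For finite potent $\varphi$ let $\mathcal A_\varphi=\{\alpha\circ\varphi\circ\beta:\alpha\in X_\varphi(GD1),\ \beta\in X_\varphi(1GD)\}$ and $\mathcal B_\varphi=\{\beta\circ\varphi\circ\alpha:\beta\in X_\varphi(1GD),\ \alpha\in X_\varphi(GD1)\}$. For finite potent $\varphi,\psi$: - $\varphi\leq^{GD1-1GD}\psi$ means there are $\tilde\varphi_1,\tilde\varphi_2\in\mathcal A_\varphi$ with $\varphi\tilde\varphi_1=\psi\tilde\varphi_1$ and $\tilde\varphi_2\varphi=\tilde\varphi_2\psi$; - $\varphi\leq^{1GD-GD1}\psi$ means there are $\varphi_1^+,\varphi_2^+\in\mathcal B_\varphi$ with $\varphi\varphi_1^+=\psi\varphi_1^+$ and $\varphi_2^+\varphi=\varphi_2^+\psi$; - $\varphi\leq^{GD}\psi$ (G-Drazin partial order) means there is $\varphi^{GD}\in X_\varphi(GD)$ with $\varphi\varphi^{GD}=\psi\varphi^{GD}$ and $\varphi^{GD}\varphi=\varphi^{GD}\psi$; - $\varphi\leq^-\psi$ (minus partial order) means $X_\psi^{fp}(1)\subseteq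 X_\varphi^{fp}(1)$. *)

(* Defs.v *)
From mathcomp Require Import all_boot all_algebra.
From mathcomp Require Import boolp classical_sets functions.

Set Implicit Arguments.
Unset Strict Implicit.
Unset Printing Implicit Defensive.

Import GRing.Theory.

Local Open Scope ring_scope.
Local Open Scope classical_set_scope.

(* Endomorphisms are elements of {linear V -> V}; equations between them are
   stated as pointwise equalities (=1) of the underlying functions, and the
   power phi^n is iter n phi. *)

Definition is_subspace (k : fieldType) (V : lmodType k) (W : set V) : Prop :=
  GRing.submod_closed [in W].

(* W is the linear span of a finite family; in particular it is a subspace. *)
Definition finite_dim (k : fieldType) (V : lmodType k) (W : set V) : Prop :=
  exists (n : nat) (b : 'I_n -> V),
    W = range (fun c : 'I_n -> k => \sum_(i < n) c i *: b i).

Definition finite_potent (k : fieldType) (V : lmodType k)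
    (phi : {linear V -> V}) : Prop :=
  exists2 n : nat, (1 <= n)%N & finite_dim (range (iter n phi)).

Definition direct_sum_decomposition (k : fieldType) (V : lmodType k)
    (W U : set V) : Prop :=
  [/\ is_subspace W, is_subspace U, W `&` U = [set 0] &
      [set w + u | w in W & u in U] = [set: V]].

Definition iter_vanishes_on (k : fieldType) (V : lmodType k)
    (phi : {linear V -> V}) (U : set V) (n : nat) : Prop :=
  forall u, U u -> iter n phi u = 0.

Definition AST_decomposition (k : fieldType) (V : lmodType k)
    (phi : {linear V -> V}) (W U : set V) : Prop :=
  [/\ direct_sum_decomposition W U,
      finite_dim W,
      set_bij W W phi,
      phi @` U `<=` U &
      exists n, iter_vanishes_on phi U n].

(* m = i(phi).  Since iter 0 phi is the identity, m = 0 exactly when U = 0,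
   that is, when V is finite dimensional and phi is an automorphism. *)
Definition is_index (k : fieldType) (V : lmodType k)
    (phi : {linear V -> V}) (m : nat) : Prop :=
  exists W U : set V,
    [/\ AST_decomposition phi W U,
        iter_vanishes_on phi U m &
        forall n, iter_vanishes_on phi U n -> (m <= n)%N].

Definition inv1 (k : fieldType) (V : lmodType k) (phi : {linear V -> V}) :
    set {linear V -> V} :=
  [set chi : {linear V -> V} | phi \o chi \o phi =1 phi].

Definition inv1_fp (k : fieldType) (V : lmodType k) (phi : {linear V -> V}) :
    set {linear V -> V} :=
  [set chi : {linear V -> V} | inv1 phi chi /\ finite_potent chi].

(* The index of a finite potent endomorphism exists and is unique (uniqueness
   of the AST decomposition), so "exists m" just names it. *)
Definition invGD (k : fieldType) (V : lmodType k) (phi : {linear V -> V}) :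
    set {linear V -> V} :=
  [set chi : {linear V -> V} | phi \o chi \o phi =1 phi /\
    exists2 m, is_index phi m & chi \o iter m phi =1 iter m phi \o chi].

Definition invGD1 (k : fieldType) (V : lmodType k) (phi : {linear V -> V}) :
    set {linear V -> V} :=
  [set chi : {linear V -> V} | chi \o phi \o chi =1 chi /\
    exists phi1 phiGD : {linear V -> V},
      [/\ inv1 phi phi1, invGD phi phiGD,
          chi \o phi =1 phiGD \o phi & phi \o chi =1 phi \o phi1]].

Definition inv1GD (k : fieldType) (V : lmodType k) (phi : {linear V -> V}) :
    set {linear V -> V} :=
  [set chi : {linear V -> V} | chi \o phi \o chi =1 chi /\
    exists phi1 phiGD : {linear V -> V},
      [/\ inv1 phi phi1, invGD phi phiGD,
          chi \o phi =1 phi1 \o phi & phi \o chi =1 phi \o phiGD]].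

Definition invGD1_1GD (k : fieldType) (V : lmodType k) (phi : {linear V -> V}) :
    set {linear V -> V} :=
  [set chi : {linear V -> V} | exists alpha beta : {linear V -> V},
    [/\ invGD1 phi alpha, inv1GD phi beta & chi =1 alpha \o phi \o beta]].

Definition inv1GD_GD1 (k : fieldType) (V : lmodType k) (phi : {linear V -> V}) :
    set {linear V -> V} :=
  [set chi : {linear V -> V} | exists beta alpha : {linear V -> V},
    [/\ inv1GD phi beta, invGD1 phi alpha & chi =1 beta \o phi \o alpha]].

Definition le_GD1_1GD (k : fieldType) (V : lmodType k)
    (phi psi : {linear V -> V}) : Prop :=
  exists chi1 chi2 : {linear V -> V},
    [/\ invGD1_1GD phi chi1, invGD1_1GD phi chi2,
        phi \o chi1 =1 psi \o chi1 & chi2 \o phi =1 chi2 \o psi].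

Definition le_1GD_GD1 (k : fieldType) (V : lmodType k)
    (phi psi : {linear V -> V}) : Prop :=
  exists chi1 chi2 : {linear V -> V},
    [/\ inv1GD_GD1 phi chi1, inv1GD_GD1 phi chi2,
        phi \o chi1 =1 psi \o chi1 & chi2 \o phi =1 chi2 \o psi].

Definition le_GD (k : fieldType) (V : lmodType k)
    (phi psi : {linear V -> V}) : Prop :=
  exists chi : {linear V -> V},
    [/\ invGD phi chi, phi \o chi =1 psi \o chi & chi \o phi =1 chi \o psi].

Definition le_minus (k : fieldType) (V : lmodType k)
    (phi psi : {linear V -> V}) : Prop :=
  inv1_fp psi `<=` inv1_fp phi.

(* Main.v *)
(* Part (I): the elements of A_phi are the maps G phi G' with G, G' G-Drazin
   inverses of phi; they are again G-Drazin inverses, and chi1 phi chi2 witnesses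
   phi <=^GD psi. Part (II): as a G-Drazin inverse exists, B_phi contains g phi g
   for every {1}-inverse g, and all its elements are {1}-inverses. If phi precedes
   psi, then phi = psi chi1 phi = phi chi2 psi, so each {1}-inverse of psi is one of
   phi. Conversely, a finite potent {1}-inverse g of psi exists, and adding to it
   rank-one maps shows that ker psi is contained in ker phi and im phi in im psi;
   then g phi g is the required element of B_phi. *)

From HB Require Import structures.
Require Import Defs.
From mathcomp Require Import all_boot all_algebra.
From mathcomp Require Import boolp classical_sets functions.

Set Implicit Arguments.
Unset Strict Implicit.
Unset Printing Implicit Defensive.

Import GRing.Theory.

Local Open Scope ring_scope.
Local Open Scope classical_set_scope.

(** * Subspaces, projections and {1}-inverses in arbitrary dimension *)

Section LinearAlgebra.
Variables (k : fieldType) (V : lmodType k).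
Implicit Types (S T : set V) (f g h phi : {linear V -> V}).

Lemma exists_linear (U : lmodType k) (f : U -> V) :
  linear f -> exists g : {linear U -> V}, g =1 f.
Proof.
move=> lf; pose m := GRing.isLinear.Build k U V *:%R f lf.
by exists (HB.pack_for {linear U -> V} f m).
Qed.

Lemma iter_is_linear n (phi : {linear V -> V}) : linear (iter n phi).
Proof. by elim: n => [//|n IH] a u v; rewrite !iterS IH linearP. Qed.

HB.instance Definition _ n (phi : {linear V -> V}) :=
  GRing.isLinear.Build k V V *:%R (iter n phi) (iter_is_linear n phi).

Lemma is_subspaceP S :
  is_subspace S <-> S 0 /\ forall a u v, S u -> S v -> S (a *: u + v).
Proof.
split=> -[S0 SD]; split; rewrite ?inE // in S0 *.
  by move=> a u v /mem_set Su /mem_set Sv; apply: set_mem; apply: SD.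
by move=> a u v /set_mem Su /set_mem Sv; apply: mem_set; apply: SD.
Qed.

Lemma subspaceD S u v : is_subspace S -> S u -> S v -> S (u + v).
Proof. by case/is_subspaceP=> _ SD Su Sv; rewrite -[u]scale1r; apply: SD. Qed.

Lemma subspaceB S u v : is_subspace S -> S u -> S v -> S (u - v).
Proof.
by case/is_subspaceP=> _ SD Su Sv; rewrite addrC -scaleN1r; apply: SD.
Qed.

Lemma is_subspace_range (U : lmodType k) (f : {linear U -> V}) :
  is_subspace (range f).
Proof.
apply/is_subspaceP; split; first by exists 0; rewrite ?linear0.
by move=> a _ _ [u _ <-] [v _ <-]; exists (a *: u + v); rewrite ?linearP.
Qed.

Lemma is_subspace_ker (f : {linear V -> V}) : is_subspace [set v | f v = 0].
Proof.
apply/is_subspaceP; split; first exact: linear0.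
by move=> a u v /= fu fv; rewrite linearP fu fv scaler0 addr0.
Qed.

(** By Zorn, take T maximal among the sets closed under linear combinations that meet S at most in
    0. If the span of T and v still does so, v is in T; otherwise some nonzero a v + t in S has a !=
    0 and can be solved for v. *)
Lemma exists_complement S : is_subspace S -> exists T,
  [/\ is_subspace T, S `&` T `<=` [set 0] &
      forall v, exists s t, [/\ S s, T t & v = s + t]].
Proof.
move=> subS; have [S0 SD] := (is_subspaceP S).1 subS.
(* 0 \in T is not required here, so that the empty chain has an upper bound *)
pose P T := (forall a u v, T u -> T v -> T (a *: u + v)) /\ S `&` T `<=` [set 0].
have [F FP totF|T [[TD ST] maxT]] := @Zorn_bigcup V P.
  split=> [a u v [X FX Xu] [Y FY Yv]|v [Sv [X FX Xv]]]; last first.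
    by have [_] := FP _ FX; apply.
  have [XY|YX] := totF _ _ FX FY.
    by exists Y => //; have [+ _] := FP _ FY; apply => //; apply: XY.
  by exists X => //; have [+ _] := FP _ FX; apply => //; apply: YX.
have maxT' B : T `<=` B -> P B -> B `<=` T.
  by move=> TB PB; apply: contrapT => BT; apply: (maxT B).
have T0 : T 0.
  apply: (maxT' (T `|` [set 0])); [exact: subsetUl| |by right].
  split=> [a u v [Tu|->] [Tv|->]|v [Sv [Tv|//]]]; last exact: ST.
  - by left; apply: TD.
  - by left; rewrite addr0 -[a](subrK 1) scalerDl scale1r; apply: TD.
  - by left; rewrite scaler0 add0r.
  - by right; rewrite scaler0 addr0.
exists T; split=> //; first exact/is_subspaceP.
move=> v.
pose B := [set w | exists a t, T t /\ w = a *: v + t].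
have TB : T `<=` B by move=> t Tt; exists 0, t; rewrite scale0r add0r.
have [ST'|] := pselect (S `&` B `<=` [set 0]).
  exists 0, v; split; rewrite ?add0r //; apply: (maxT' B) => //; last first.
    by exists 1, 0; rewrite scale1r addr0.
  split=> // a _ _ [b [t [Tt ->]]] [c [t' [Tt' ->]]].
  exists (a * b + c), (a *: t + t'); split; first exact: TD.
  by rewrite scalerDr scalerA scalerDl addrACA.
move=> /existsNP[s /not_implyP[[Ss [a [t [Tt sE]]]] /= /eqP s0]].
have a0 : a != 0.
  apply: contra_neq s0 => a0; apply: ST; split => //.
  by rewrite sE a0 scale0r add0r.
exists (a^-1 *: s), (- a^-1 *: t); split.
- by rewrite -[_ *: _]addr0; apply: SD.
- by rewrite -[_ *: _]addr0; apply: TD.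
by rewrite sE scalerDr scalerA mulVf // scale1r scaleNr addrK.
Qed.

Lemma exists_projection S : is_subspace S ->
  exists P : {linear V -> V}, (forall v, S (P v)) /\ (forall v, S v -> P v = v).
Proof.
move=> subS; have [T [subT ST dec]] := exists_complement subS.
have uniq s t s' t' : S s -> S s' -> T t -> T t' -> s + t = s' + t' -> s = s'.
  move=> Ss Ss' Tt Tt' e; apply/eqP; rewrite -subr_eq0; apply/eqP/ST; split.
    exact: subspaceB.
  suff -> : s - s' = t' - t by apply: subspaceB.
  by apply/eqP; rewrite subr_eq addrAC [t' + s']addrC -e addrK.
pose p v := projT1 (cid (dec v)).
have pP v : exists t, [/\ S (p v), T t & v = p v + t].
  by rewrite /p; case: (cid (dec v)).
have [|P PE] := @exists_linear V p.
  move=> a u v; have [t1 [S1 T1 e1]] := pP u; have [t2 [S2 T2 e2]] := pP v.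
  have [t [S3 T3 e3]] := pP (a *: u + v).
  have [[_ SD] [_ TD]] := ((is_subspaceP S).1 subS, (is_subspaceP T).1 subT).
  apply: (uniq _ t _ (a *: t1 + t2)) => //; [exact: SD|exact: TD|].
  by rewrite -e3 {1}e1 {1}e2 scalerDr addrACA.
have [T0 _] := (is_subspaceP T).1 subT.
exists P; split=> v; rewrite PE; have [t [S1 T1 e]] := pP v => // Sv.
by apply: (uniq _ t _ 0) => //; rewrite addr0 -e.
Qed.

Lemma exists_inv1 (f : {linear V -> V}) : inv1 f !=set0.
Proof.
have [P [kerP Pid]] := exists_projection (is_subspace_ker f).
have [Q [imQ Qid]] := exists_projection (is_subspace_range f).
pose p v := projT1 (cid2 (imQ v)).
have pP v : f (p v) = Q v by rewrite /p; case: cid2.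
have fP v : f (P v) = 0 := kerP v.
(* The section [p] need not be linear, but u - P u depends only on f u, so subtracting P (p v) makes
   it linear. *)
have Pf u v : f u = f v -> u - P u = v - P v.
  move=> e; have Puv : P u - P v = u - v.
    by rewrite -linearB Pid //= linearB e subrr.
  by apply/eqP; rewrite subr_eq -addrA [- _ + _]addrC Puv addrC subrK.
have [|h hE] := @exists_linear V (fun v => p v - P (p v)).
  move=> a u v; rewrite (Pf _ (a *: p u + p v)); last first.
    by rewrite pP !linearP !pP.
  by rewrite (linearP P) scalerBr opprD addrACA.
by exists h => v /=; rewrite hE linearB fP subr0 pP Qid.
Qed.

Lemma exists_rank_one (x y : V) : y != 0 ->
  exists f : {linear V -> V}, f y = x /\ forall v, exists c, f v = c *: x.
Proof.
move=> y0; have subL : is_subspace [set v | exists c, v = c *: y].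
  apply/is_subspaceP; split; first by exists 0; rewrite scale0r.
  move=> a _ _ [b ->] [c ->]; exists (a * b + c).
  by rewrite scalerA scalerDl.
have [P [imP Pid]] := exists_projection subL.
have [c cE] := choice imP; have yI : injective (fun a => a *: y).
  move=> a b /eqP; rewrite -subr_eq0 -scalerBl scaler_eq0 (negPf y0) orbF.
  by rewrite subr_eq0 => /eqP.
have [|f fE] := @exists_linear V (fun v => c v *: x).
  move=> a u v; rewrite scalerA -scalerDl; congr (_ *: _); apply: yI => /=.
  by rewrite -cE linearP !cE scalerA -scalerDl.
exists f; split=> [|v]; last by rewrite fE; exists (c v).
rewrite fE (_ : c y = 1) ?scale1r //; apply: yI.
by rewrite -cE scale1r Pid //; exists 1; rewrite scale1r.
Qed.

Lemma finite_dim_range n (L : {linear 'rV[k]_n -> V}) : finite_dim (range L).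
Proof.
exists n, (fun i => L (delta_mx 0 i)); apply/seteqP; split=> [_ [c _ <-]|_ [c _ <-]].
  by exists (c 0) => //; rewrite [in RHS](row_sum_delta c) linear_sum /=;
    apply: eq_bigr => i _; rewrite linearZ.
exists (\sum_(i < n) c i *: delta_mx 0 i) => //.
by rewrite linear_sum /=; apply: eq_bigr => i _; rewrite linearZ.
Qed.

(** The extra coordinate, which [L] ignores, makes the size a successor, so that square matrices of
    this size form a nonzero ring. *)
Lemma finite_dim_rangeP S : finite_dim S ->
  exists n (L : {linear 'rV[k]_n.+1 -> V}), S = range L.
Proof.
move=> [n [b ->]]; exists n.
have [|L LE] := @exists_linear 'rV_n.+1
    (fun c => \sum_(i < n) c 0 (lift ord0 i) *: b i).
  move=> a u v; rewrite scaler_sumr -big_split; apply: eq_bigr => i _ /=.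
  by rewrite !mxE scalerDl scalerA.
exists L; apply/seteqP; split=> _ [c _ <-].
  exists (\row_j oapp c 0 (unlift ord0 j)) => //; rewrite LE.
  by apply: eq_bigr => i _; rewrite mxE liftK.
by exists (fun i => c 0 (lift ord0 i)).
Qed.

Lemma finite_dim_sub n (L : {linear 'rV[k]_n -> V}) S :
  is_subspace S -> S `<=` range L -> finite_dim S.
Proof.
move=> subS SL; have [P [imP Pid]] := exists_projection subS.
suff -> : S = range (P \o L) by exact: finite_dim_range.
apply/seteqP; split=> [v Sv|_ [c _ <-]]; last exact: imP.
by have [c _ Lc] := SL v Sv; exists c; rewrite //= Lc Pid.
Qed.

End LinearAlgebra.

(** * Finite potent endomorphisms: index, G-Drazin inverses, finite potent {1}-inverses *)

Section FinitePotent.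
Variables (k : fieldType) (V : lmodType k).
Implicit Types (S : set V) (f g h phi psi chi : {linear V -> V}).

Lemma iter_comm phi (r : V -> V) n v :
  (forall u, r (phi u) = phi (r u)) -> r (iter n phi v) = iter n phi (r v).
Proof. by move=> rphi; elim: n => [//|n IH]; rewrite !iterS rphi IH. Qed.

(** r is p(phi), built by Horner's scheme; it is defined on all of V, and [L] need not be
    injective. *)
Lemma horner_mx_lift phi n (L : {linear 'rV[k]_n.+1 -> V}) (A : 'M[k]_n.+1) p :
    (forall c, phi (L c) = L (c *m A)) ->
  exists r : {linear V -> V}, (forall v, r (phi v) = phi (r v)) /\
    forall c, r (L c) = L (c *m horner_mx A p).
Proof.
move=> phiL; elim/poly_ind: p => [|p a [r [rphi rL]]].
  exists (\0%R : {linear V -> V}); split=> [v|c] /=; first by rewrite linear0.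
  by rewrite rmorph0 mulmx0 linear0.
exists (phi \o r \+ a \*: idfun); split=> [v|c] /=.
  by rewrite rphi linearD linearZ.
rewrite rmorphD rmorphM /= horner_mx_X horner_mx_C -mulmxE mulmxDr mulmxA.
by rewrite mul_mx_scalar linearD linearZ -phiL rL.
Qed.

(* With A the matrix of phi on a spanning family of the range of phi^n, write
   char_poly A = 'X^a * q with q(0) != 0. As q = q(0) + 'X * q', Cayley-Hamilton
   gives A^a = A^(a+1) R with R = - q(0)^-1 q'(A), and r is the same polynomial
   in phi. *)
Lemma finite_potent_fitting phi : finite_potent phi ->
  exists N (r : {linear V -> V}), [/\ (0 < N)%N, finite_dim (range (iter N phi)),
      forall v, r (phi v) = phi (r v) &
      forall v, iter N phi v = iter N.+1 phi (r v)].
Proof.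
move=> [n n0 /finite_dim_rangeP[d [L LE]]].
have imL c : range (iter n phi) (L c) by rewrite LE; exists c.
(* The range of phi^n is stable under phi; any choice of coordinates for the images of the
   generators will do. *)
have /choice[A_ A_E] (i : 'I_d.+1) : exists c, L c = phi (L (delta_mx 0 i)).
  have [x _ <-] := imL (delta_mx 0 i).
  rewrite -iterS iterSr.
  have : range (iter n phi) (iter n phi (phi x)) by exists (phi x).
  by rewrite LE => -[c _ <-]; exists c.
pose A := \matrix_i A_ i.
have phiL c : phi (L c) = L (c *m A).
  rewrite mulmx_sum_row {1}(row_sum_delta c) !linear_sum; apply: eq_bigr => i _ /=.
  by rewrite !linearZ rowK A_E.
have [a [q q0 CE]] := multiplicity_XsubC (char_poly A) 0.
rewrite polyC0 subr0 in CE; rewrite -size_poly_gt0 size_char_poly /= in q0.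
have [q' qE] : exists q', q = q' * 'X + q.[0]%:P.
  have /factor_theorem[q' q'E] : root (q - q.[0]%:P) 0.
    by rewrite /root !hornerE subrr.
  by exists q'; rewrite polyC0 subr0 in q'E; rewrite -q'E subrK.
have [r [rphi rL]] := horner_mx_lift (- q.[0]^-1 *: q') phiL.
have iterL m c : iter m phi (L c) = L (c *m A ^+ m).
  elim: m => [|m IH]; first by rewrite expr0 mulmx1.
  by rewrite iterS IH phiL -mulmxA mulmxE -exprSr.
have AE : A ^+ a = A ^+ a.+1 * horner_mx A (- q.[0]^-1 *: q').
  have := Cayley_Hamilton A; rewrite CE {1}qE mulrDl -mulrA -exprS mulrC.
  rewrite rmorphD !rmorphM /= !rmorphXn /= horner_mx_X horner_mx_C.
  rewrite -!mulmxE mul_scalar_mx addrC => /eqP; rewrite addr_eq0 => /eqP qA.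
  by rewrite linearZ /= -scalemxAr scaleNr -scalerN -qA scalerA mulVf ?scale1r.
(* phi^n carries v into the range of [L], where [AE] gives phi^a = phi^(a+1) r. *)
exists (a + n)%N, r; split=> // [||v]; first by rewrite addn_gt0 n0 orbT.
  have -> : range (iter (a + n) phi) = range (iter a phi \o L).
    apply/seteqP; split=> [_ [v _ <-]|_ [c _ <-]].
      have [c _ cE] : range L (iter n phi v) by rewrite -LE; exists v.
      by exists c; rewrite //= cE iterD.
    by have [v _ vE] := imL c; exists v; rewrite //= iterD vE.
  exact: finite_dim_range.
have [c _ cE] : range L (iter n phi v) by rewrite -LE; exists v.
by rewrite -addSn -(iter_comm _ _ rphi) !iterD -cE !iterL rL AE -mulmxA.
Qed.

(** The W'-component of an element of U is killed by a power of phi, hence is 0, as phi is injective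
    on W'. By symmetry the nilpotent parts agree, and so do the indices. *)
Lemma AST_nilpotent_part phi (W U W' U' : set V) :
  AST_decomposition phi W U -> AST_decomposition phi W' U' -> U `<=` U'.
Proof.
move=> [_ _ _ _ [n Un]] [[subW _ _ WU'] _ [WW Winj _] _ [n' U'n]] v Uv.
have [w Ww [u U'u wuE]] : [set w + u | w in W' & u in U'] v by rewrite WU'.
have W0 : W' 0 by have [] := (is_subspaceP W').1 subW.
have iterW m x : W' x -> W' (iter m phi x).
  by move=> Wx; elim: m => [//|m IH]; apply: WW.
have iterI m x : W' x -> iter m phi x = 0 -> x = 0.
  move=> Wx; elim: m => [//|m IH] /= e; apply: IH; apply: Winj; rewrite ?inE //.
  - exact: iterW.
  - by rewrite linear0.
suff w0 : w = 0 by rewrite -wuE w0 add0r.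
apply: (iterI (n' + n)%N) => //.
have -> : w = v - u by rewrite -wuE addrK.
rewrite linearB /= iterD (Un _ Uv) addnC iterD (U'n _ U'u).
by rewrite !linear0 ?oppr0 addr0.
Qed.

Lemma is_index_unique phi m m' : is_index phi m -> is_index phi m' -> m = m'.
Proof.
move=> [W [U [ast Um mmin]]] [W' [U' [ast' Um' mmin']]].
apply/eqP; rewrite eqn_leq; apply/andP; split.
  by apply: mmin => u /(AST_nilpotent_part ast ast'); apply: Um'.
by apply: mmin' => u /(AST_nilpotent_part ast' ast); apply: Um.
Qed.

(* With e the idempotent phi^N r^N, which projects onto the range of phi^N along
   the kernel of phi^N, the inverse is r on the range of e and an arbitrary
   {1}-inverse on the kernel of e. *)
Lemma exists_invGD phi : finite_potent phi -> invGD phi !=set0.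
Proof.
move=> /finite_potent_fitting[N [r [N0 fdW rphi rN]]].
have phiNr j v : iter (j + N) phi (iter j r v) = iter N phi v.
  elim: j => [//|j IH]; rewrite -IH addSnnS !iterD.
  by rewrite [iter j.+1 r v]iterS -rN.
have riter n v : r (iter n phi v) = iter n phi (r v) by apply: iter_comm.
have iterr n v : iter n r (phi v) = phi (iter n r v).
  by rewrite -(iter_comm n v (fun u => esym (rphi u))).
pose e := iter N phi \o iter N r : {linear V -> V}.
have ephi v : e (phi v) = phi (e v) by rewrite /e /= iterr -iterSr.
have eiter n v : e (iter n phi v) = iter n phi (e v) by apply: iter_comm.
have phiNe v : iter N phi (e v) = iter N phi v.
  by rewrite /e /= -iterD phiNr.
have eE v : e v = iter N r (iter N phi v).
  by rewrite (iter_comm _ _ (iterr N)).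
have ee v : e (e v) = e v by rewrite [LHS]eE phiNe -eE.
have eW v : range (iter N phi) v -> e v = v.
  by move=> [x _ <-]; rewrite eiter phiNe.
have eU v : iter N phi v = 0 -> e v = 0 by move=> v0; rewrite eE v0 linear0.
have phire v : phi (r (e v)) = e v.
  by rewrite /e /= riter -iterS -rN.
have Ue v : iter N phi (v - e v) = 0 by rewrite linearB /= phiNe subrr.
have subW : is_subspace (range (iter N phi)) by apply: is_subspace_range.
have ast : AST_decomposition phi (range (iter N phi)) [set v | iter N phi v = 0].
  split => //; last by exists N.
  - split=> //; first exact: is_subspace_ker.
      apply/seteqP; split=> [v [Wv v0]|v ->].
        by rewrite /= -(eW _ Wv) eU.
      by split; [exists 0; rewrite ?linear0|exact: linear0].
    apply/seteqP; split=> // v _; exists (e v); first by exists (iter N r v).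
    by exists (v - e v); rewrite // addrC subrK.
  - split.
    + by move=> _ [v _ <-]; exists (phi v); rewrite // -iterSr.
    + move=> u v /set_mem Wu /set_mem Wv uv; apply/eqP; rewrite -subr_eq0.
      have Wuv := subspaceB subW Wu Wv; rewrite -(eW _ Wuv) eU //.
      by rewrite -(prednK N0) iterSr linearB uv subrr linear0.
    + move=> _ [v _ <-]; exists (iter N phi (r v)); first by exists (r v).
      by rewrite -iterS -rN.
  - by move=> _ [v /= v0 <-]; rewrite -iterSr iterS v0 linear0.
(* The index is the least exponent killing the kernel of phi^N; it may be smaller than N. *)
have exm : exists m, `[< iter_vanishes_on phi [set v | iter N phi v = 0] m >].
  by exists N; apply/asboolP.
have [m /asboolP Um mmin] := ex_minnP exm.
have Um' v : iter m phi (v - e v) = 0 by apply: Um; apply: Ue.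
have idx : is_index phi m.
  exists (range (iter N phi)), [set v | iter N phi v = 0]; split=> // n Un.
  by apply: mmin; apply/asboolP.
have [g gE] := exists_inv1 phi.
pose p := idfun \- e : {linear V -> V}.
have eB u v : e (u - v) = e u - e v by exact: linearB.
have pE u : p u = u - e u by [].
have pphi u : p (phi u) = phi (p u) by rewrite !pE ephi linearB.
have pp u : p (p u) = p u by rewrite !pE eB ee subrr subr0.
exists ((r \o e) \+ (p \o g \o p)); split=> [v|].
  change (phi (r (e (phi v)) + p (g (p (phi v)))) = phi v).
  rewrite [p (phi v)]pphi linearD phire -[phi (p (g _))]pphi.
  by rewrite [phi (g _)](gE (p v)) -pphi pp pE addrC subrK.
exists m => // v.
change (r (e (iter m phi v)) + p (g (p (iter m phi v))) =
        iter m phi (r (e v) + p (g (p v)))).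
(* phi^m kills the range of p = id - e, so the second summand vanishes on both sides. *)
have -> : p (iter m phi v) = 0
  by rewrite pE eiter -[RHS](Um' v) [RHS]linearB.
have iterD' x y : iter m phi (x + y) = iter m phi x + iter m phi y.
  exact: linearD.
by rewrite !linear0 iterD' pE Um' !addr0 eiter riter.
Qed.

(** Q splits an element of psi(T) into a part in psi(S), where chi is kept, and a remainder in
    psi(T), lifted to T by P' after a {1}-inverse of psi P'. *)
Lemma extend_section psi chi S T :
    is_subspace S -> is_subspace T -> S `<=` T ->
    (forall v, S v -> psi (chi (psi v)) = psi v /\ S (chi (psi v))) ->
  exists chi' : {linear V -> V},
    (forall v, S v -> chi' (psi v) = chi (psi v)) /\
    (forall v, T v -> psi (chi' (psi v)) = psi v /\ T (chi' (psi v))).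
Proof.
move=> subS subT ST chiS.
have [P [imP Pid]] := exists_projection subS.
have [P' [imP' P'id]] := exists_projection subT.
have [s sE] := exists_inv1 (psi \o P').
have [Q [imQ Qid]] := exists_projection (is_subspace_range (psi \o P)).
have QS v : S v -> Q (psi v) = psi v.
  by move=> Sv; apply: Qid; exists v; rewrite //= Pid.
exists ((chi \o Q) \+ (P' \o s \o (idfun \- Q))); split=> v Sv /=.
  by rewrite QS // subrr !linear0 addr0.
have [u _ /= uE] := imQ (psi v).
rewrite -uE -linearB; have Tvu : T (v - P u) by apply: subspaceB => //; apply: ST.
have [cS Sc] := chiS _ (imP u).
split; last by apply: subspaceD => //; apply: ST.
have := sE (v - P u); rewrite /= (P'id _ Tvu) => sE'.
by rewrite [psi (chi _ + _)]linearD cS sE' linearB addrC subrK.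
Qed.

(* Let C be a complement of the range of psi and F_0 = 0, F_(j+1) = C + psi F_j.
   An inverse that kills C and is on the range of psi a section compatible with
   the F_j maps F_(j+1) to F_j; its n-th power kills F_n, and V is the sum of F_n
   and the range of psi^n. *)
Lemma exists_inv1_fp psi : finite_potent psi -> inv1_fp psi !=set0.
Proof.
move=> [n n0 /finite_dim_rangeP[d [L LE]]].
have [Q [imQ Qid]] := exists_projection (is_subspace_range psi).
have Qpsi v : Q (psi v) = psi v by apply: Qid; exists v.
pose F j : set V :=
  iter j (fun S => [set c + psi u | c in [set c | Q c = 0] & u in S]) [set 0].
have subF j : is_subspace (F j).
  elim: j => [|j /is_subspaceP[F0 FD]]; apply/is_subspaceP.
    by split=> // a _ _ -> ->; rewrite scaler0 addr0.
  split; first by exists 0; [exact: linear0|exists 0; rewrite ?linear0 ?addr0].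
  move=> a _ _ [b /= Qb [u Fu <-]] [c /= Qc [v Fv <-]].
  exists (a *: b + c) => /=; first by rewrite linearP Qb Qc scaler0 addr0.
  by exists (a *: u + v); [exact: FD|rewrite linearP scalerDr addrACA].
have FS j : F j `<=` F j.+1.
  elim: j => [_ ->|j IH _ [c Qc [u Fu <-]]].
    by have [] := (is_subspaceP (F 1)).1 (subF 1).
  by exists c => //; exists u => //; apply: IH.
(* v - Q v lies in C, and Q v = psi w with w decomposed by induction. *)
have dec j v : exists u w, F j u /\ v = u + iter j psi w.
  elim: j v => [|j IH] v; first by exists 0, v; rewrite add0r.
  have [w _ wE] := imQ v; have [u [x [Fu xE]]] := IH w.
  exists (v - Q v + psi u), x; split; last first.
    by rewrite -addrA iterS -linearD -xE wE subrK.
  exists (v - Q v) => /=; last by exists u.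
  by rewrite linearB (Qid (Q v)) ?subrr.
(* Each extension keeps the earlier values, so one chi respects all F_i with i <= n at once. *)
have [chi chiF] : exists chi : {linear V -> V}, forall i, (i <= n)%N ->
    forall v, F i v -> psi (chi (psi v)) = psi v /\ F i (chi (psi v)).
  elim: n {n0 LE} => [|n [chi chiF]].
    exists (\0%R : {linear V -> V}) => i; rewrite leqn0 => /eqP-> _ ->.
    by split=> //=; rewrite !linear0.
  have [chi' [chi'E chi'F]] :=
    extend_section (subF n) (subF n.+1) (@FS n) (chiF n (leqnn n)).
  exists chi' => i; rewrite leq_eqVlt => /orP[/eqP-> //|]; rewrite ltnS => ilen v Fv.
  rewrite chi'E; first exact: chiF.
  elim: n ilen {chi chiF chi' chi'E chi'F} => [|n IH].
    by rewrite leqn0 => /eqP <-.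
  by rewrite leq_eqVlt => /orP[/eqP <- //|/IH/FS].
have subVT : is_subspace [set: V] by apply/is_subspaceP.
(* Taking T = V extends the section from psi F_n to the whole range of psi. *)
have [g [gE gT]] := extend_section (subF n) subVT (@subsetT _ _) (chiF n (leqnn n)).
pose h := g \o Q : {linear V -> V}.
have hF j v : (j <= n)%N -> F j v -> iter j h v = 0.
  elim: j v => [//|j IH] v jn [c Qc [u Fu <-]].
  have Fnu : F n u.
    elim: n jn {n0 LE chiF gE IH} => [//|n IH].
    by rewrite ltnS leq_eqVlt => /orP[/eqP <-|/IH/FS //]; apply: FS.
  rewrite iterSr [h _]/= linearD (Qc : Q c = 0) add0r Qpsi gE //.
  by apply: IH; [exact: ltnW|exact: (chiF _ (ltnW jn) _ Fu).2].
exists h; split=> [v|] /=; first by rewrite Qpsi; have [] := gT v I.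
exists n => //; apply: (@finite_dim_sub _ _ _ (iter n h \o L)).
  exact: is_subspace_range.
move=> _ [v _ <-]; have [u [w [Fu ->]]] := dec n v.
have [c _ cE] : range L (iter n psi w) by rewrite -LE; exists w.
by exists c; rewrite //= linearD /= (hF n u) // add0r cE.
Qed.

(** By induction, (chi + h)^m v is chi^m v plus a combination of the chi^i x with i < m, so the n-th
    power maps into the range of chi^n plus a finite span. *)
Lemma finite_potent_rank_one chi h x : finite_potent chi ->
  (forall v, exists c, h v = c *: x) -> finite_potent (chi \+ h).
Proof.
move=> [n n0 /finite_dim_rangeP[d [L LE]]] hx; exists n => //.
have [|M ME] := @exists_linear k V 'rV_(d.+1 + n) (fun c =>
    L (lsubmx c) + \sum_(i < n) rsubmx c 0 i *: iter i chi x).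
  move=> a u v; rewrite !linearP scalerDr addrACA scaler_sumr -big_split.
  congr (_ + _); apply: eq_bigr => i _ /=.
  by rewrite !mxE scalerDl scalerA.
apply: (@finite_dim_sub _ _ _ M); first exact: is_subspace_range.
have iterE m v : exists c : 'I_m -> k, iter m (chi \+ h) v =
    iter m chi v + \sum_(i < m) c i *: iter i chi x.
  elim: m => [|m [c cE]]; first by exists (fun=> 0); rewrite big_ord0 addr0.
  rewrite iterS; have [a aE] := hx (iter m (chi \+ h) v).
  (* Applying chi shifts the old coefficients by one; h contributes the coefficient of x at index
     0. *)
  exists (fun i => oapp c a (unlift ord0 i)).
  rewrite [LHS]/= aE cE linearD linear_sum big_ord_recl unlift_none -addrA /=.
  congr (_ + _); rewrite addrC; congr (_ + _); apply: eq_bigr => i _.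
  by rewrite liftK linearZ.
move=> _ [v _ <-]; have [c ->] := iterE n v.
have [b _ bE] : range L (iter n chi v) by rewrite -LE; exists v.
exists (row_mx b (\row_i c i)) => //; rewrite ME row_mxKl row_mxKr bE.
by congr (_ + _); apply: eq_bigr => i _; rewrite mxE.
Qed.

End FinitePotent.

(** * The elements of A_phi and B_phi, and the orders they define *)

Section Orders.
Variables (k : fieldType) (V : lmodType k).
Implicit Types (g h G phi psi chi : {linear V -> V}).

(** The index is unique, so G and G' commute with the same phi^m, and phi does too. *)
Lemma invGD_mid phi G G' chi :
  invGD phi G -> invGD phi G' -> chi =1 G \o phi \o G' -> invGD phi chi.
Proof.
move=> [G1 [m im Gm]] [G1' [m' im' Gm']] chiE.
rewrite (is_index_unique im' im) in Gm'.
split=> [v|]; first by rewrite /= chiE [LHS](G1 _) [LHS](G1' v).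
exists m => // v; rewrite /= !chiE /= [G' _]Gm' /= -iterS iterSr.
exact: Gm.
Qed.

(** alpha phi beta = G phi beta = G phi G'. *)
Lemma invGD1_1GD_mid phi chi : invGD1_1GD phi chi -> exists G G',
  [/\ invGD phi G, invGD phi G' & chi =1 G \o phi \o G'].
Proof.
move=> [al [be [[_ [_ [G [_ GG alE _]]]] [_ [_ [G' [_ GG' _ beE]]]] chiE]]].
by exists G, G'; split=> // v; rewrite chiE [LHS]alE /= [phi (be v)]beE.
Qed.

Lemma mid_invGD1_1GD phi G : invGD phi G -> invGD1_1GD phi (G \o phi \o G).
Proof.
move=> GG; have G1 v : phi (G (phi v)) = phi v by have [+ _] := GG; apply.
exists (G \o phi \o G), (G \o phi \o G); split=> [||v]; last by rewrite /= !G1.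
  split=> [v|]; first by rewrite /= !G1.
  by exists G, G; split=> // v; rewrite /= G1.
split=> [v|]; first by rewrite /= !G1.
by exists G, G; split=> // v; rewrite /= G1.
Qed.

Lemma inv1GD_GD1_inv1 phi chi : inv1GD_GD1 phi chi -> inv1 phi chi.
Proof.
move=> [be [al [[_ [g [_ [gg _ beE _]]]] [_ [g' [_ [gg' _ _ alE]]]] chiE]]] v.
by rewrite /= chiE /= [be _]beE /= [phi (g _)]gg [LHS]alE [LHS]gg'.
Qed.

(** Take beta = g phi G and alpha = G phi g with G a G-Drazin inverse; both copies of G cancel in
    beta phi alpha. *)
Lemma mid_inv1GD_GD1 phi g :
  finite_potent phi -> inv1 phi g -> inv1GD_GD1 phi (g \o phi \o g).
Proof.
move=> /exists_invGD[G GG] gg.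
have G1 v : phi (G (phi v)) = phi v by have [+ _] := GG; apply.
have g1 v : phi (g (phi v)) = phi v by apply: gg.
exists (g \o phi \o G), (G \o phi \o g); split=> [||v].
- split=> [v|]; first by rewrite /= g1 G1.
  by exists g, G; split=> // v; rewrite /= ?G1 ?g1.
- split=> [v|]; first by rewrite /= G1 g1.
  by exists g, G; split=> // v; rewrite /= ?G1 ?g1.
- by rewrite /= !G1.
Qed.

(* A rank-one h with psi h psi = 0 can be added to a finite potent {1}-inverse
   of psi, so that phi h phi = 0 for every such h. *)
Lemma le_minus_ker_range phi psi : finite_potent psi -> le_minus phi psi ->
  (forall v, psi v = 0 -> phi v = 0) /\ range phi `<=` range psi.
Proof.
move=> fp_psi le; have [chi chiX] := exists_inv1_fp fp_psi.
have [chi1 _] := le _ chiX; have [chi2 fp_chi] := chiX.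
have hle h x : (forall v, exists c, h v = c *: x) ->
    (forall v, psi (h (psi v)) = 0) -> forall v, phi (h (phi v)) = 0.
  move=> hx h0 v; have [|phi1 _] := le (chi \+ h).
    split=> [u|]; last exact: finite_potent_rank_one hx.
    by rewrite /= linearD h0 addr0 [LHS]chi2.
  by have := phi1 v; rewrite /= linearD [phi (chi _)]chi1 -[RHS]addr0 => /addrI.
split=> [x psix|_ [v _ <-]].
  (* h sends phi x to x and has image in the line of x, which psi kills; so phi x = phi h phi x =
     0. *)
  have [//|phix] := eqVneq (phi x) 0; have [h [hE hx]] := exists_rank_one x phix.
  rewrite -{1}hE; apply: (hle h x) => // v; have [c ->] := hx (psi v).
  by rewrite linearZ psix /= scaler0.
have [Q [imQ Qid]] := exists_projection (is_subspace_range psi).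
have [<- //|y0] := eqVneq (Q (phi v)) (phi v).
(* h sends phi v - Q (phi v) to v, so h (id - Q) vanishes on the range of psi but maps phi v to v;
   this forces phi v = 0. *)
rewrite eq_sym -subr_eq0 in y0; have [h [hE hx]] := exists_rank_one v y0.
have h0 u : psi ((h \o (idfun \- Q)) (psi u)) = 0.
  by rewrite /= Qid ?subrr ?linear0 //; exists u.
have := hle (h \o (idfun \- Q)) v (fun u => hx _) h0 v; rewrite /= hE => ->.
by exists 0; rewrite ?linear0.
Qed.

End Orders.

Theorem theorem4p37 (k : fieldType) (V : lmodType k)
    (phi psi : {linear V -> V})
    (fp_phi : finite_potent phi) (fp_psi : finite_potent psi) :
  (le_GD1_1GD phi psi <-> le_GD phi psi) /\
  (le_1GD_GD1 phi psi <-> le_minus phi psi).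
Proof.
split; split.
- move=> [chi1 [chi2 [/invGD1_1GD_mid[G1 [G1' [GG1 GG1' E1]]]]]].
  move=> /invGD1_1GD_mid[G2 [G2' [GG2 GG2' E2]]] c1 c2.
  have GD1 := invGD_mid GG1 GG1' E1; have GD2 := invGD_mid GG2 GG2' E2.
  (* The left factor chi1 gives the equation with psi on the left, the right factor chi2 the one
     with psi on the right. *)
  exists (chi1 \o phi \o chi2); split; first exact: invGD_mid GD1 GD2 _.
    by move=> v; exact: c1.
  by move=> v; rewrite /= [chi2 (phi v)]c2.
- move=> [G [GG c1 c2]].
  exists (G \o phi \o G), (G \o phi \o G).
  split; [exact: mid_invGD1_1GD|exact: mid_invGD1_1GD| |] => v.
    exact: c1.
  by rewrite /= [G (phi v)]c2.
- move=> [chi1 [chi2 [/inv1GD_GD1_inv1 I1 /inv1GD_GD1_inv1 I2 c1 c2]]].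
  move=> chi [Ichi fp_chi]; split=> // v.
  have phil u : phi u = psi (chi1 (phi u)) by rewrite -[LHS]I1 [LHS]c1.
  have phir u : phi u = phi (chi2 (psi u)) by rewrite -[LHS]I2 /= [chi2 _]c2.
  (* phi chi phi = phi chi2 psi chi psi chi1 phi = phi chi2 psi chi1 phi = phi chi1 phi = phi. *)
  by rewrite [LHS]phir /= [in LHS](phil v) [psi (chi _)]Ichi -phir [LHS]I1.
move=> le; have [kerP imP] := le_minus_ker_range fp_psi le.
have [g gX] := exists_inv1_fp fp_psi.
have [Ipsi _] := gX; have [Iphi _] := le _ gX.
have psig v : psi (g (phi v)) = phi v.
  by have [|u _ <-] := imP (phi v); [exists v|exact: Ipsi].
(* g psi v - v lies in the kernel of psi, hence in that of phi. *)
have gpsi v : phi (g (psi v)) = phi v.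
  apply/eqP; rewrite -subr_eq0 -linearB; apply/eqP/kerP.
  by rewrite linearB [psi (g _)]Ipsi subrr.
exists (g \o phi \o g), (g \o phi \o g).
split; [exact: mid_inv1GD_GD1|exact: mid_inv1GD_GD1| |] => v.
  by rewrite /= psig [LHS]Iphi.
by rewrite /= gpsi [phi (g _)]Iphi.
Qed.
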